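(* Let $(\mathbf M,g)=\mathbb H^d(\mathbb R)$, $d\ge2$, be the $d$-dimensional real hyperbolic manifold, and let $\mathcal A$, $B$, $X$, $Y$, $\alpha,\beta,\sigma,\theta$ be as in the context. Let $u_0\in Y$ and $f\in AAP(\mathbb R_+,X)$. Then the linear problem $$\partial_tu+\mathcal A u=B(f)(t),\qquad u|_{t=0}=u_0,$$ has one and only one asymptotically almost periodic mild solution $\hat u\in AAP(\mathbb R_+,Y)$, and it satisfies $$\|\hat u\|_{C_b(\mathbb R_+,Y)}\le\|u_0\|_Y+M\|f\|_{C_b(\mathbb R_+,X)},\qquad M:=\alpha\left(\beta^{\theta-1}\mathbf\Gamma(1-\theta)+\frac1\beta\right),$$ where $\mathbf\Gamma$ is the Gamma function.
   Context: Setting. $\mathbb R_+=[0,\infty)$. $\Gamma(T\mathbf M)$ denotes vector fields on $\mathbf M$. The operator $\mathcal A$ acts on vector fields by $\mathcal A u=-\overrightarrow{\Delta}u+(d-1)u$, where $\overrightarrow{\Delta}=-\nabla^*\nabla$ is the Bochner Laplacian, and $e^{-t\mathcal A}$ is the associated (vectorial heat) semigroup. $Y=Y(\Gamma(T\mathbf M))$ is a Banach space of vector fields (e.g. $L^p(\Gamma(T\mathbf M))$) and $X$ is a Banach space of tensor fields (e.g. $L^{p/2}(\Gamma(T\mathbf M\otimes T\mathbf M))$ or $L^p(\Gamma(T\mathbf M))$), and $B$ is a linear operator ($B=\operatorname{div}$ or $B=\mathrm{Id}$, or $\mathbb P\operatorname{div}$ with $\mathbb P$ the Kodaira–Hodge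 projection) such that for all $t>0$ $$\|e^{-t\mathcal A}u_0\|_Y\le e^{-\sigma t}\|u_0\|_Y\ (u_0\in Y),\qquad \|e^{-t\mathcal A}Bw\|_Y\le\alpha(t^{-\theta}+1)e^{-\beta t}\|w\|_X\ (w\in X),$$ with constants $0\le\theta<1$, $\alpha>0$, $0<\sigma<\beta$ depending only on $B,X,Y$ ($\theta=0$ and $\alpha=1$ if $X=Y$). Here $e^{-t\mathcal A}B$ is understood as a bounded operator $X\to Y$ for $t>0$. Mild solution of the linear problem: the function $$u(t)=e^{-t\mathcal A}u_0+\int_0^te^{-(t-\tau)\mathcal A}B(f)(\tau)\,d\tau,\quad t\ge 0.$$ Function spaces. For a Banach space $Z$: $C_b(\mathbb R_+,Z)$ is the space of bounded continuous functions $\mathbb R_+\to Z$ with the sup norm, and similarly $C_b(\mathbb R,Z)$. A function $h\in C_b(\mathbb R,Z)$ is almost periodic ($h\in AP(\mathbb R,Z)$) if for each $\epsilon>0$ there is $l_\epsilon>0$ such that every interval of length $l_\epsilon$ contains at least one number $T$ with $\sup_{t\in\mathbb R}\|h(t+T)-h(t)\|_Z<\epsilon$. $C_0(\mathbb R_+,Z)$ is the space of continuous $\varphi:\mathbb R_+\to Z$ with $\lim_{t\to\infty}\|\varphi(t)\|_Z=0$. A continuous $f:\mathbb R_+\to Z$ is asymptotically almost periodic ($f\in AAP(\mathbb R_+,Z)$) if $f(t)=h(t)+\varphi(t)$ for $t\ge0$ with some $h\in AP(\mathbb R,Z)$ and $\varphi\in C_0(\mathbb R_+,Z)$. *)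

(* Defs.v *)
(* Stdlib reals with Coquelicot; MathComp supplies only ordinals and big operators. *)
From Stdlib Require Import Reals.
From mathcomp Require Import all_boot.
From Coquelicot Require Import Coquelicot.

Open Scope R_scope.

Notation "'\sumR_' ( i < n ) F" := (\big[Rplus/0]_(i < n) F)
  (at level 41, F at level 41, i, n at level 50).

(* H^d is the Poincare ball {|x| < 1} with g = (2 / (1 - |x|^2))^2 delta
   (sectional curvature -1).  Fields are functions on R^d in the global
   coordinates of the ball; only their values on the ball matter. *)

Definition point (d : nat) : Type := 'I_d -> R.

Definition sqnorm {d} (x : point d) : R := \sumR_(i < d) (x i ^ 2).

Definition in_H {d} (x : point d) : Prop := sqnorm x < 1.

Definition kron {d} (i j : 'I_d) : R := if i == j then 1 else 0.

Definition metric {d} (i j : 'I_d) (x : point d) : R :=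
  (2 / (1 - sqnorm x)) ^ 2 * kron i j.

Definition metric_inv {d} (i j : 'I_d) (x : point d) : R :=
  / (2 / (1 - sqnorm x)) ^ 2 * kron i j.

Definition shift {d} (x : point d) (i : 'I_d) (s : R) : point d :=
  fun j => x j + s * kron i j.

Definition partial {d} (i : 'I_d) (F : point d -> R) (x : point d) : R :=
  Derive (fun s => F (shift x i s)) 0.

(* Components of a tensor of order k: [idx d 1] reduces to ['I_d] and
   [idx d 2] to ['I_d * 'I_d]. *)
Definition idx (d k : nat) : Type := iterop k prod ('I_d : Type) unit.

Definition tfield (d k : nat) : Type := point d -> idx d k -> R.

Definition vfield (d : nat) : Type := tfield d 1.

(* Gamma^k_ij of the Levi-Civita connection *)
Definition christoffel {d} (k i j : 'I_d) (x : point d) : R :=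
  / 2 * \sumR_(l < d) (metric_inv k l x *
    (partial i (metric j l) x + partial j (metric i l) x
     - partial l (metric i j) x)).

(* (nabla_j v)^k *)
Definition nabla {d} (v : vfield d) (j k : 'I_d) (x : point d) : R :=
  partial j (fun y => v y k) x + \sumR_(l < d) (christoffel k j l x * v x l).

(* (nabla_i T)_j^k for T a (1,1)-tensor with components T_j^k = T j k *)
Definition nabla11 {d} (T : 'I_d -> 'I_d -> point d -> R)
    (i j k : 'I_d) (x : point d) : R :=
  partial i (T j k) x
  + \sumR_(l < d) (christoffel k i l x * T j l x)
  - \sumR_(l < d) (christoffel l i j x * T l k x).

(* The formal adjoint of nabla: (nabla^* T)^k = - g^ij (nabla_i T)_j^k. *)
Definition nabla_adj {d} (T : 'I_d -> 'I_d -> point d -> R) : vfield d :=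
  fun x k => - \sumR_(i < d) \sumR_(j < d) (metric_inv i j x * nabla11 T i j k x).

Definition bochner {d} (v : vfield d) : vfield d :=
  fun x k => - nabla_adj (nabla v) x k.

Definition opA {d} (v : vfield d) : vfield d :=
  fun x k => - bochner v x k + (INR d - 1) * v x k.

Definition smooth {d} (F : point d -> R) : Prop :=
  forall (s : seq 'I_d) (x : point d), in_H x ->
    continuous (foldr partial F s) x /\
    forall i, ex_derive (fun t => foldr partial F s (shift x i t)) 0.

Definition smooth_vfield {d} (v : vfield d) : Prop :=
  forall k : 'I_d, smooth (fun x => v x k).

(* Lebesgue null sets; on the ball they are the null sets of the Riemannian
   volume, whose density is smooth and positive. *)
Definition null_set {d} (N : point d -> Prop) : Prop :=
  forall eps : R, 0 < eps ->
  exists a b : nat -> point d,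
    (forall n i, a n i <= b n i) /\
    (forall x, N x -> exists n, forall i, a n i <= x i <= b n i) /\
    (forall m, sum_n (fun n => \big[Rmult/1]_(i < d) (b n i - a n i)) m <= eps).

Definition ae_eq {d k} (v w : tfield d k) : Prop :=
  null_set (fun x => in_H x /\ exists I, v x I <> w x I).

(* A Banach space whose elements are a.e.-classes of tensor fields of order k
   on H^d; [ts_rep v z] says that v is a representative of z. *)
Record tensor_space (d k : nat) := TensorSpace {
  ts_car :> CompleteNormedModule R_AbsRing;
  ts_rep : tfield d k -> ts_car -> Prop;
  ts_rep_ex : forall z, exists v, ts_rep v z;
  ts_rep_ae : forall v w z, ts_rep v z -> (ts_rep w z <-> ae_eq v w);
  ts_rep_inj : forall v z z', ts_rep v z -> ts_rep v z' -> z = z';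
  ts_rep_plus : forall v w z z', ts_rep v z -> ts_rep w z' ->
    ts_rep (fun x I => v x I + w x I) (plus z z');
  ts_rep_scal : forall (c : R) v z, ts_rep v z ->
    ts_rep (fun x I => c * v x I) (scal c z) }.

Arguments ts_rep {d k} t _ _.

Definition C0_semigroup {Y : CompleteNormedModule R_AbsRing}
    (E : R -> Y -> Y) : Prop :=
  (forall t, 0 <= t -> is_linear (E t)) /\
  (forall y, E 0 y = y) /\
  (forall s t y, 0 <= s -> 0 <= t -> E (s + t) y = E s (E t y)) /\
  (forall y, filterlim (fun t => E t y) (at_right 0) (locally y)).

(* y lies in the domain of the generator of E, with value z there *)
Definition generator {Y : CompleteNormedModule R_AbsRing}
    (E : R -> Y -> Y) (y z : Y) : Prop :=
  filterlim (fun h => scal (/ h) (minus (E h y) y)) (at_right 0) (locally z).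

(* v is a smooth field with v and A v both in Y, of classes y and z *)
Definition smooth_graph {d} (Y : tensor_space d 1) (y z : Y) : Prop :=
  exists v : vfield d,
    smooth_vfield v /\ ts_rep Y v y /\ ts_rep Y (opA v) z.

(* E t = e^{-tA}: the generator of E is the closure in Y of -A acting on the
   smooth fields v with v, A v in Y. *)
Definition heat_semigroup {d} (Y : tensor_space d 1) (E : R -> Y -> Y) : Prop :=
  C0_semigroup E /\
  (forall y z, smooth_graph Y y z -> generator E y (opp z)) /\
  (forall y z, generator E y z -> forall eps : R, 0 < eps ->
     exists y' z', smooth_graph Y y' z' /\
       norm (minus y' y) < eps /\ norm (minus (opp z') z) < eps).

(* B is linear on the dense subspace D; its values off D are irrelevant. *)
Definition densely_defined_linear {X Y : CompleteNormedModule R_AbsRing}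
    (D : X -> Prop) (B : X -> Y) : Prop :=
  D zero /\
  (forall w w', D w -> D w' -> D (plus w w') /\ B (plus w w') = plus (B w) (B w')) /\
  (forall (c : R) w, D w -> D (scal c w) /\ B (scal c w) = scal c (B w)) /\
  (forall w (eps : R), 0 < eps -> exists w', D w' /\ norm (minus w' w) < eps).

(* EB t is the bounded operator e^{-tA} B : X -> Y *)
Definition bounded_composition {X Y : CompleteNormedModule R_AbsRing}
    (E : R -> Y -> Y) (D : X -> Prop) (B : X -> Y) (EB : R -> X -> Y) : Prop :=
  forall t, 0 < t ->
    is_linear (EB t) /\ (forall w, D w -> EB t w = E t (B w)).

(* Functions on R_+ are functions on R used only at t >= 0. *)
Definition Rplus_set (t : R) : Prop := 0 <= t.
Definition Rall_set (t : R) : Prop := True.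

Definition sup_norm {Z : CompleteNormedModule R_AbsRing}
    (D : R -> Prop) (u : R -> Z) : Rbar :=
  Lub_Rbar (fun r => exists t, D t /\ r = norm (u t)).

Definition Cb {Z : CompleteNormedModule R_AbsRing}
    (D : R -> Prop) (u : R -> Z) : Prop :=
  continuous_on D u /\ exists K : R, forall t, D t -> norm (u t) <= K.

Definition AP {Z : CompleteNormedModule R_AbsRing} (h : R -> Z) : Prop :=
  Cb Rall_set h /\
  forall eps : R, 0 < eps -> exists l : R, 0 < l /\
    forall a : R, exists T : R, a <= T <= a + l /\
      Rbar_lt (sup_norm Rall_set (fun t => minus (h (t + T)) (h t))) eps.

Definition C0 {Z : CompleteNormedModule R_AbsRing} (phi : R -> Z) : Prop :=
  continuous_on Rplus_set phi /\ is_lim (fun t => norm (phi t)) p_infty 0.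

Definition AAP {Z : CompleteNormedModule R_AbsRing} (f : R -> Z) : Prop :=
  continuous_on Rplus_set f /\
  exists h phi : R -> Z, AP h /\ C0 phi /\
    forall t, 0 <= t -> f t = plus (h t) (phi t).

(* The integrand may be singular at tau = t, so the integral over [0, t) is an
   improper Riemann integral; at t = 0 the integral is zero. *)
Definition mild_solution {X Y : CompleteNormedModule R_AbsRing}
    (E : R -> Y -> Y) (EB : R -> X -> Y) (u0 : Y) (f : R -> X) (u : R -> Y) : Prop :=
  u 0 = E 0 u0 /\
  forall t, 0 < t -> exists J : Y,
    is_RInt_gen (fun tau => EB (t - tau) (f tau)) (at_point 0) (at_left t) J /\
    u t = plus (E t u0) J.

Definition Gamma (x : R) : R :=
  RInt_gen (fun t => Rpower t (x - 1) * exp (- t))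
    (at_right 0) (Rbar_locally p_infty).

(* Main.v *)
Require Import Defs.
From Stdlib Require Import Reals Lra FunctionalExtensionality.
From mathcomp Require Import all_boot.
From Coquelicot Require Import Coquelicot.

(** Write [EB s] for the bounded operator e^(-sA) B.  A mild solution is given by
    an explicit formula, so it is unique, and everything concerns
    [[
      u(t) = E t u0 + int_0^t EB s (f (t - s)) ds,
    ]]
    called [forward] below, where the memory variable s = t - tau puts the
    singularity of the kernel at s = 0.  The bound
    kappa(s) = alpha (s^(-theta) + 1) e^(-beta s) on the norm of [EB s] has
    integral exactly M over the positive half-line ([heat_kernel_integral]), which
    makes the integral converge and gives the norm estimate ([forward_le]).

    Let f = h + phi with h almost periodic and phi vanishing at infinity.  The
    almost periodic part of u is the ancient solution driven by h since time -oo,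
    [[
      J(t) = int_0^oo EB s (h (t - s)) ds     ([ancient]).
    ]]
    It depends linearly on h, commutes with translations in time, and is bounded
    by M times the supremum of h.  Hence if T moves h by at most e, then T moves
    J by at most M e, and J is almost periodic ([AP_ancient]).

    The engine is a cocycle identity: a solution at time t is [E r] applied to
    the solution at time t - r, plus the Duhamel integral over the last r units of
    time ([ancient_cocycle], [duhamel_cocycle], [forward_cocycle]).  It is used
    three times.
    - With r = t it yields
      u(t) - J(t) = E t (u0 - J(0)) + int_0^t EB s (phi (t - s)) ds,
      whose first term decays like e^(-sigma t).
    - With r = t/2 it shows that the second term vanishes too: the forcing by phi
      on [0, t/2] is damped by e^(-sigma t/2), and on [t/2, t] phi is small
      ([duhamel_vanishing]).
    - With r small it gives the continuity of u and J, because the integral over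
      a short time is small and orbits of the semigroup are continuous
      ([continuous_of_cocycle]).

    The identity itself rests on E r (EB s w) = EB (r + s) w, which holds on the
    dense domain of B by the semigroup law and extends to all w by boundedness
    ([semigroup_composition]). *)

Open Scope R_scope.

(** * Norms, linear maps and Riemann integrals *)

(** In a complete normed module the same difference can be elaborated through two
    convertible group structures; linear arithmetic identifies the norms only
    once they have been made syntactically equal. *)
Ltac norm_lra :=
  repeat match goal with
  | H : context [@minus (CompleteNormedModule.AbelianGroup ?K ?V)] |- _ =>
      change (@minus (CompleteNormedModule.AbelianGroup K V)) with
        (@minus (NormedModule.AbelianGroup K (CompleteNormedModule.NormedModule K V))) in H
  | |- context [@minus (CompleteNormedModule.AbelianGroup ?K ?V)] =>
      change (@minus (CompleteNormedModule.AbelianGroup K V)) with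
        (@minus (NormedModule.AbelianGroup K (CompleteNormedModule.NormedModule K V)))
  end; lra.

Lemma ball_Rabs (x e y : R) : ball x e y = (Rabs (y - x) < e).
Proof. by []. Qed.

Lemma filterlim_norm_near {T} {V : NormedModule R_AbsRing} {F : (T -> Prop) -> Prop}
  {f : T -> V} {l : V} {eps : R} :
  filterlim f F (locally l) -> 0 < eps -> F (fun x => norm (minus (f x) l) < eps).
Proof. by move=> H He; exact: H _ (locally_ball_norm l (mkposreal eps He)). Qed.

Lemma filterlim_of_norm {T} {V : NormedModule R_AbsRing} (F : (T -> Prop) -> Prop)
  {FF : Filter F} (f : T -> V) (l : V) :
  (forall eps, 0 < eps -> F (fun x => norm (minus (f x) l) < eps)) ->
  filterlim f F (locally l).
Proof.
by move=> H; apply/filterlim_locally_ball_norm => eps; apply: H; exact: cond_pos.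
Qed.

Lemma norm_minus_sym {V : NormedModule R_AbsRing} (x y : V) :
  norm (minus x y) = norm (minus y x).
Proof. by rewrite -(opp_minus y x) norm_opp. Qed.

Lemma norm_minus_triangle {V : NormedModule R_AbsRing} (x y z : V) :
  norm (minus x z) <= norm (minus x y) + norm (minus y z).
Proof. by rewrite (minus_trans y x z); apply: norm_triangle. Qed.

Lemma norm_minus_le {V : NormedModule R_AbsRing} (x y : V) :
  norm (minus x y) <= norm x + norm y.
Proof. by rewrite -(norm_opp y); apply: norm_triangle. Qed.

Lemma plus_minus_cancel {V : NormedModule R_AbsRing} (x y : V) :
  minus (plus x y) x = y.
Proof. by rewrite /minus (plus_comm x) -plus_assoc plus_opp_r plus_zero_r. Qed.

Lemma is_RInt_linear {U V : NormedModule R_AbsRing} (l : U -> V) (f : R -> U) a b I :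
  is_linear l -> is_RInt f a b I -> is_RInt (fun s => l (f s)) a b (l I).
Proof.
move=> Hl Hf.
have Hsum ptd : Riemann_sum (fun s => l (f s)) ptd = l (Riemann_sum f ptd).
  move: ptd; apply: SF_cons_ind => [x|h ptd IH].
    by rewrite /Riemann_sum /= linear_zero.
  by rewrite !Riemann_sum_cons IH (linear_plus l Hl) (linear_scal l Hl).
apply: (filterlim_ext (fun ptd => l (scal (sign (b - a)) (Riemann_sum f ptd)))).
  by move=> ptd; rewrite (linear_scal l Hl) Hsum.
apply: filterlim_comp Hf _; exact: (linear_cont l I Hl).
Qed.

(** * Improper integrals over the positive half-line *)

Section IntegralOverPositiveReals.

Context {V : CompleteNormedModule R_AbsRing}.

(** The integrands may be singular at 0. *)
Definition continuous_pos (q : R -> V) : Prop := forall s, 0 < s -> continuous q s.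

Lemma ex_RInt_pos (q : R -> V) a b :
  continuous_pos q -> 0 < a -> 0 < b -> ex_RInt q a b.
Proof.
move=> Hq Ha Hb; apply: ex_RInt_continuous => z [Hz _]; apply: Hq.
by apply: Rlt_le_trans Hz; apply: Rmin_glb_lt.
Qed.

Lemma is_RInt_pos (q : R -> V) a b :
  continuous_pos q -> 0 < a -> 0 < b -> is_RInt q a b (RInt q a b).
Proof. by move=> *; apply: RInt_correct; apply: ex_RInt_pos. Qed.

Lemma RInt_pos_Chasles (q : R -> V) a b c :
  continuous_pos q -> 0 < a -> 0 < b -> 0 < c ->
  plus (RInt q a b) (RInt q b c) = RInt q a c.
Proof. by move=> *; apply: RInt_Chasles; apply: ex_RInt_pos. Qed.

(** This lemma and the next replace the relational limit that defines an improper
    integral by estimates on the total function [RInt], which are the form in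
    which integrals over different intervals can be compared. *)
Lemma is_RInt_gen_norm_near {q : R -> V} {Fa Fb : (R -> Prop) -> Prop} {l : V} {eps : R} :
  is_RInt_gen q Fa Fb l -> 0 < eps ->
  exists P Q, [/\ Fa P, Fb Q &
    forall a b, P a -> Q b -> norm (minus (RInt q a b) l) < eps].
Proof.
move=> H He; have [P Q FP FQ HPQ] := H _ (locally_ball_norm l (mkposreal eps He)).
exists P, Q; split=> // a b Pa Qb.
by have [y [/= /is_RInt_unique -> ]] := HPQ a b Pa Qb.
Qed.

Lemma is_RInt_gen_of_norm (q : R -> V) (Fa Fb : (R -> Prop) -> Prop)
  {FFa : Filter Fa} {FFb : Filter Fb} (l : V) :
  continuous_pos q -> Fa (fun a => 0 < a) -> Fb (fun b => 0 < b) ->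
  (forall eps, 0 < eps -> exists P Q, [/\ Fa P, Fb Q &
    forall a b, P a -> Q b -> norm (minus (RInt q a b) l) < eps]) ->
  is_RInt_gen q Fa Fb l.
Proof.
move=> Hq Ha Hb H.
apply: (filterlimi_lim_ext_loc (fun ab => RInt q ab.1 ab.2)).
  exists (fun a => 0 < a) (fun b => 0 < b) => //= a b; exact: is_RInt_pos.
apply: filterlim_of_norm => eps He.
by have [P [Q [FP FQ HPQ]]] := H eps He; exists P Q.
Qed.

End IntegralOverPositiveReals.

Lemma at_right_pos : at_right 0 (fun a => 0 < a).
Proof. by exists (mkposreal 1 Rlt_0_1). Qed.

Lemma p_infty_gt (r : R) : Rbar_locally p_infty (fun b => r < b).
Proof. by exists r. Qed.

Lemma at_point_pos (r : R) : 0 < r -> at_point r (fun b => 0 < b).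
Proof. by []. Qed.

Lemma p_infty_pos : Rbar_locally p_infty (fun b => 0 < b).
Proof. exact: p_infty_gt. Qed.

#[local] Hint Resolve at_right_pos p_infty_pos at_point_pos : core.

Lemma RInt_norm_le_abs {V : CompleteNormedModule R_AbsRing} (q : R -> V) (g : R -> R) a b :
  continuous_pos q -> continuous_pos (g : R -> R_CompleteNormedModule) ->
  (forall s, 0 < s -> norm (q s) <= g s) -> 0 < a -> 0 < b ->
  norm (RInt q a b) <= Rabs (RInt g a b).
Proof.
move=> Hq Hg Hqg Ha Hb.
have Hle u v : 0 < u -> u <= v -> norm (RInt q u v) <= Rabs (RInt g u v).
  move=> Hu Huv; apply: Rle_trans (Rle_abs _).
  apply: (norm_RInt_le q g u v) => //; last 2 first.
  - by apply: is_RInt_pos => //; lra.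
  - by apply: is_RInt_pos => //; lra.
  by move=> x Hx; apply: Hqg; lra.
case: (Rle_dec a b) => [|] Hab; first exact: Hle.
rewrite -(opp_RInt_swap q); last by apply: ex_RInt_pos.
rewrite -(opp_RInt_swap g); last by apply: (ex_RInt_pos (g : R -> R_CompleteNormedModule)).
rewrite norm_opp /opp /= Rabs_Ropp; apply: Hle; lra.
Qed.

(** Cauchy criterion: two integrals of [q] with ends near 0 and near infinity
    differ by integrals over two outer intervals, and each of these is dominated
    by a difference of two integrals of [g] that share an end. *)
Lemma ex_RInt_gen_dominated {V : CompleteNormedModule R_AbsRing}
  (q : R -> V) (g : R -> R) (M : R) :
  continuous_pos q -> continuous_pos (g : R -> R_CompleteNormedModule) ->
  (forall s, 0 < s -> norm (q s) <= g s) ->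
  is_RInt_gen g (at_right 0) (Rbar_locally p_infty) M ->
  ex_RInt_gen q (at_right 0) (Rbar_locally p_infty).
Proof.
move=> Hq Hg Hqg HM.
suff [L HL] : exists L : V, filterlim (fun ab => RInt q ab.1 ab.2)
    (filter_prod (at_right 0) (Rbar_locally p_infty)) (locally L).
  exists L; apply: filterlimi_lim_ext_loc HL.
  by exists (fun a => 0 < a) (fun b => 0 < b) => // a b /=; exact: is_RInt_pos.
apply/filterlim_locally_cauchy => eps.
have He : 0 < eps / 4 by have := cond_pos eps; lra.
have [P [Q [FP FQ HPQ]]] := 
  is_RInt_gen_norm_near (V := R_CompleteNormedModule) HM He.
exists (fun ab => (P ab.1 /\ 0 < ab.1) /\ (Q ab.2 /\ 0 < ab.2)); split.
  exists (fun a => P a /\ 0 < a) (fun b => Q b /\ 0 < b) => //; exact: filter_and.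
move=> [a b] [a' b'] /= [[Pa a0] [Qb b0]] [[Pa' a0'] [Qb' b0']].
apply: norm_compat1.
(* The four ends are compared through [a', b], common to both differences. *)
have g1 := HPQ _ _ Pa Qb; have g2 := HPQ _ _ Pa' Qb; have g3 := HPQ _ _ Pa' Qb'.
rewrite -(RInt_pos_Chasles q a' a b') // -(RInt_pos_Chasles q a b b') //.
set x := RInt q a' a; set y := RInt q a b; set z := RInt q b b'.
have -> : minus (plus x (plus y z)) y = plus x z.
  by rewrite plus_assoc (plus_comm x) -plus_assoc plus_minus_cancel.
have Hx := RInt_norm_le_abs q g a' a Hq Hg Hqg a0' a0.
have Hz := RInt_norm_le_abs q g b b' Hq Hg Hqg b0 b0'.
have c1 := RInt_pos_Chasles (V := R_CompleteNormedModule) g a' a b Hg a0' a0 b0.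
have c2 := RInt_pos_Chasles (V := R_CompleteNormedModule) g a' b b' Hg a0' b0 b0'.
apply: Rle_lt_trans (norm_triangle _ _) _.
move: g1 g2 g3 c1 c2 Hx Hz; rewrite -/x -/z /norm /minus /plus /opp /= /abs /=.
by do 5! [move=> /Rabs_lt_between ? | move=> ?];
   rewrite /Rabs; do 2 case: Rcase_abs; lra.
Qed.

(** Convergence at the two ends is independent: for a fixed far end [b],
    the integrals from [a] and [a'] to [r] differ exactly as those to [b] do. *)
Lemma is_RInt_gen_cut {V : CompleteNormedModule R_AbsRing} (q : R -> V) (L : V) (r : R) :
  continuous_pos q -> 0 < r ->
  is_RInt_gen q (at_right 0) (Rbar_locally p_infty) L ->
  exists L1, is_RInt_gen q (at_right 0) (at_point r) L1 /\
             is_RInt_gen q (at_point r) (Rbar_locally p_infty) (minus L L1).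
Proof.
move=> Hq Hr HL.
have [L1 HL1] : ex_RInt_gen q (at_right 0) (at_point r).
  suff [L1 HL1] : exists L1 : V, filterlim (fun a => RInt q a r) (at_right 0) (locally L1).
    exists L1; apply: is_RInt_gen_of_norm => // eps He.
    exists (fun a => norm (minus (RInt q a r) L1) < eps), (fun b => b = r).
    split=> //; first exact: (filterlim_norm_near HL1 He).
    by move=> a _ Ha ->.
  apply/filterlim_locally_cauchy => eps.
  have He : 0 < eps / 2 by have := cond_pos eps; lra.
  have [P [Q [FP FQ HPQ]]] := is_RInt_gen_norm_near HL He.
  have [b [Qb b0]] := filter_ex _ (filter_and _ _ FQ p_infty_pos).
  exists (fun a => P a /\ 0 < a); split; first exact: filter_and.
  move=> a a' [Pa a0] [Pa' a0']; apply: norm_compat1.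
  have -> : minus (RInt q a' r) (RInt q a r) = minus (RInt q a' b) (RInt q a b).
    rewrite -(RInt_pos_Chasles q a' r b) // -(RInt_pos_Chasles q a r b) //.
    set x := RInt q a' r; set y := RInt q a r; set z := RInt q r b.
    rewrite (plus_comm y z) /minus opp_plus !plus_assoc.
    by rewrite -(plus_assoc x) plus_opp_r plus_zero_r.
  apply: Rle_lt_trans (norm_minus_triangle _ L _) _.
  rewrite (double_var eps); apply: Rplus_lt_compat; first exact: HPQ.
  by rewrite norm_minus_sym; exact: HPQ.
exists L1; split=> //; apply: is_RInt_gen_of_norm => // eps He.
have He2 : 0 < eps / 2 by lra.
have [P [Q [FP FQ HPQ]]] := is_RInt_gen_norm_near HL He2.
have [P1 [Q1 [FP1 FQ1 HPQ1]]] := is_RInt_gen_norm_near HL1 He2.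
exists (fun a => a = r), (fun b => Q b /\ 0 < b); split=> //; first exact: filter_and.
move=> _ b -> [Qb b0].
have [a [[Pa P1a] a0]] := filter_ex _ (filter_and _ _ (filter_and _ _ FP FP1) at_right_pos).
have -> : RInt q r b = minus (RInt q a b) (RInt q a r).
  by rewrite -(RInt_pos_Chasles q a r b) // plus_minus_cancel.
set x := RInt q a b; set y := RInt q a r.
have -> : minus (minus x y) (minus L L1) = minus (minus x L) (minus y L1).
  rewrite /minus !opp_plus !opp_opp -!plus_assoc; f_equal.
  by rewrite !plus_assoc (plus_comm (opp y)).
apply: Rle_lt_trans (norm_minus_le _ _) _.
have := HPQ _ _ Pa Qb; have := HPQ1 _ _ P1a FQ1; rewrite -/x -/y; lra.
Qed.

(** [F] stands for either a point or infinity; [r] keeps the upper end away from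
    the lower one, so that the integrals run from left to right. *)
Lemma is_RInt_gen_norm_le {V : CompleteNormedModule R_AbsRing} (F : (R -> Prop) -> Prop)
  {FF : ProperFilter F} (q : R -> V) (g : R -> R) (r C m : R) (L : V) :
  0 < r -> F (fun b => r <= b) ->
  F (fun b => forall s, 0 < s <= b -> norm (q s) <= C * g s) ->
  is_RInt_gen q (at_right 0) F L -> is_RInt_gen g (at_right 0) F m ->
  norm L <= C * m.
Proof.
move=> Hr Fr Fq HL Hm.
apply: (RInt_gen_norm q (fun s => C * g s)) HL _; last exact: (is_RInt_gen_scal g C).
- exists (fun a => 0 < a < r) (fun b => r <= b) => //; last by move=> a b /=; lra.
  exists (mkposreal r Hr) => y /= Hy y0; split=> //.
  by move: Hy; rewrite ball_Rabs /= => /Rabs_lt_between; lra.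
- exists (fun a => 0 < a) (fun b => forall s, 0 < s <= b -> norm (q s) <= C * g s) => //.
  by move=> a b a0 /= H x Hx; apply: H; lra.
Qed.

(** The source of the cocycle identities.  If [p'] after time [r] is the image
    under [l] of [p] restarted at time 0, then the integral of [p'] splits into
    the part up to [r] and the image of the integral of [p].  The lower end of the
    integral of [p] is a limit at 0, so the integral of [p'] starting at [r] is
    first replaced by one starting at [r + a]; since [p'] is bounded near [r],
    this costs O(a). *)
Lemma is_RInt_gen_shift {V : CompleteNormedModule R_AbsRing}
  (F F' : (R -> Prop) -> Prop) {FF : Filter F} {FF' : Filter F'}
  (p p' : R -> V) (l : V -> V) (r : R) (L L1 : V) :
  continuous_pos p -> continuous_pos p' -> is_linear l -> 0 < r ->
  (forall s, 0 < s -> p' (r + s) = l (p s)) ->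
  F (fun b => 0 < b) -> filterlim (fun b => b - r) F' F ->
  is_RInt_gen p (at_right 0) F L -> is_RInt_gen p' (at_right 0) (at_point r) L1 ->
  is_RInt_gen p' (at_right 0) F' (plus L1 (l L)).
Proof.
move=> Hp Hp' Hl Hr Hpp F0 FF'F HL HL1.
apply: is_RInt_gen_Chasles HL1 _.
have F'r : F' (fun b => 0 < b - r) by exact: FF'F F0.
have F'0 : F' (fun b => 0 < b) by apply: filter_imp F'r => b; lra.
apply: is_RInt_gen_of_norm => // eps He.
have [A [A0 HA]] := linear_norm l Hl.
have HeA : 0 < eps / 2 / A by apply: Rdiv_lt_0_compat => //; lra.
have [P [Q [FP FQ HPQ]]] := is_RInt_gen_norm_near HL HeA.
have [K HK] := bounded_continuity p' r (r + 1) (fun x Hx => Hp' x ltac:(lra)).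
have K0 : 0 < K by apply: Rle_lt_trans (norm_ge_0 (p' r)) (HK r _); lra.
have HeK : 0 < Rmin 1 (eps / 2 / K).
  by apply: Rmin_glb_lt; [lra | apply: Rdiv_lt_0_compat => //; lra].
have Fsmall : at_right 0 (fun a => a < Rmin 1 (eps / 2 / K)).
  exists (mkposreal _ HeK) => y /= Hy y0.
  by move: Hy; rewrite ball_Rabs /= => /Rabs_lt_between; lra.
have [a [[Pa a0] asmall]] :=
  filter_ex _ (filter_and _ _ (filter_and _ _ FP at_right_pos) Fsmall).
exists (fun a => a = r), (fun b => Q (b - r) /\ 0 < b - r); split=> //.
  by apply: filter_and => //; exact: FF'F FQ.
move=> _ b -> [Qb b0].
have Hint : RInt p' (r + a) b = l (RInt p a (b - r)).
  apply: is_RInt_unique.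
  apply: (is_RInt_ext (fun y => scal 1 (l (p (1 * y + - r))))).
    move=> y [Hy _]; have ry : r < y.
      by apply: Rle_lt_trans Hy; apply: Rmin_glb; lra.
    have -> : 1 * y + - r = y - r by ring.
    rewrite -Hpp; last by lra.
    by rewrite Rplus_minus; exact: scal_one.
  apply: (is_RInt_comp_lin (fun s => l (p s))).
  have -> : 1 * (r + a) + - r = a by ring.
  have -> : 1 * b + - r = b - r by ring.
  by apply: is_RInt_linear => //; exact: is_RInt_pos.
have -> : minus (RInt p' r b) (l L) =
    plus (RInt p' r (r + a)) (l (minus (RInt p a (b - r)) L)).
  rewrite (linear_minus l) // -Hint -(RInt_pos_Chasles p' r (r + a) b) //; try lra.
  by rewrite /minus plus_assoc.
have Hsmall : norm (RInt p' r (r + a)) <= (r + a - r) * K.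
  apply: (norm_RInt_le_const p' r (r + a)); first by lra.
    move=> x Hx; apply: Rlt_le; apply: HK; have := Rmin_l 1 (eps / 2 / K); lra.
  by apply: is_RInt_pos => //; lra.
have aK : a * K < eps / 2.
  have := Rlt_le_trans _ _ _ asmall (Rmin_r _ _).
  by move/(Rmult_lt_compat_r K _ _ K0); rewrite /Rdiv Rmult_assoc Rinv_l; lra.
have lA : norm (l (minus (RInt p a (b - r)) L)) < eps / 2.
  apply: Rle_lt_trans (HA _) _.
  have := HPQ _ _ Pa Qb; move/(Rmult_lt_compat_l A _ _ A0).
  by have -> : A * (eps / 2 / A) = eps / 2 by field; lra.
apply: Rle_lt_trans (norm_triangle _ _) _; lra.
Qed.

(** * Asymptotically almost periodic functions *)

Lemma norm_le_sup_norm {Z : CompleteNormedModule R_AbsRing} (D : R -> Prop) (u : R -> Z) t :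
  D t -> Rbar_le (norm (u t)) (sup_norm D u).
Proof.
by move=> Dt; apply: (proj1 (Lub_Rbar_correct _)); exists t.
Qed.

Lemma sup_norm_le {Z : CompleteNormedModule R_AbsRing} (D : R -> Prop) (u : R -> Z) (C : Rbar) :
  (forall t, D t -> Rbar_le (norm (u t)) C) -> Rbar_le (sup_norm D u) C.
Proof.
move=> H; apply: (proj2 (Lub_Rbar_correct _)) => _ [t [Dt ->]]; exact: H.
Qed.

Lemma continuous_on_Rall {Z : UniformSpace} (h : R -> Z) :
  continuous_on Rall_set h <-> forall t, continuous h t.
Proof.
split=> Hh t.
- move=> P HP; have [d Hd] := Hh t I P HP; exists d => s Hs; exact: Hd s Hs I.
- move=> _ P HP; have [d Hd] := Hh t P HP; exists d => s Hs _; exact: Hd s Hs.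
Qed.

Definition bounded_continuous {Z : NormedModule R_AbsRing} (G : R -> Z) : Prop :=
  (forall t, continuous G t) /\ exists C, forall t, norm (G t) <= C.

Definition vanishing {Z : NormedModule R_AbsRing} (g : R -> Z) : Prop :=
  forall eps, 0 < eps -> exists T, forall t, T < t -> norm (g t) < eps.

Lemma bound_ge0 {Z : NormedModule R_AbsRing} (G : R -> Z) C :
  (forall t, norm (G t) <= C) -> 0 <= C.
Proof. by move=> HC; have := HC 0; have := norm_ge_0 (G 0); lra. Qed.

Lemma bounded_continuous_minus {Z : CompleteNormedModule R_AbsRing} (G H : R -> Z) :
  bounded_continuous G -> bounded_continuous H ->
  bounded_continuous (fun t => minus (G t) (H t)).
Proof.
move=> [HG [C HC]] [HH [C' HC']]; split=> [t|]; first exact: continuous_minus.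
exists (C + C') => t; apply: Rle_trans (norm_minus_le _ _) _.
have := HC t; have := HC' t; lra.
Qed.

(** Passing to functions on the whole line, bounded and continuous there, lets one
    treat the forcing and its almost periodic part by the same integrals.  The
    vanishing part is extended to negative times by its value at 0. *)
Lemma AAP_extend {X : CompleteNormedModule R_AbsRing} (f : R -> X) : AAP f ->
  exists G h, [/\ AP h, bounded_continuous G, bounded_continuous h,
    (forall t, 0 <= t -> f t = G t) & vanishing (fun t => minus (G t) (h t))].
Proof.
move=> [_ [h [phi [Hh [[phic phi0] fE]]]]].
have Hbc : bounded_continuous h.
  move: Hh => [[hc [C HC]] _]; split; first exact/continuous_on_Rall.
  by exists C => t; exact: HC.
set psi := fun t => phi (Rmax 0 t).
have psic t : continuous psi t.
  apply: (filterlim_comp _ _ _ (Rmax 0) phi); last exact: phic (Rmax_l 0 t).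
  move=> P [d Hd]; exists d => s Hs; apply: Hd; last exact: Rmax_l.
  move: Hs; rewrite !ball_Rabs.
  by move=> /Rabs_lt_between Hs; apply/Rabs_lt_between; rewrite /Rmax; do 2 case: Rle_dec; lra.
have psiE t : 0 <= t -> psi t = phi t by move=> t0; rewrite /psi Rmax_right.
have psivan : vanishing psi.
  move=> eps He; have [T HT] := proj2 (is_lim_spec _ _ _) phi0 (mkposreal eps He).
  exists (Rmax 0 T) => t Ht.
  have t0 := Rle_lt_trans _ _ _ (Rmax_l _ _) Ht.
  have tT := Rle_lt_trans _ _ _ (Rmax_r _ _) Ht.
  by rewrite psiE; [have := HT t tT; rewrite /= => /Rabs_lt_between; lra | lra].
have [K HK] : exists K, forall t, norm (psi t) <= K.
  have [T HT] := psivan 1 Rlt_0_1.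
  have [K HK] := bounded_continuity psi 0 (Rmax 0 T) (fun x _ => psic x).
  exists (Rmax 1 K) => t; case: (Rle_dec (Rmax 0 T) t) => Ht.
    case: (Rle_lt_or_eq _ _ Ht) => [Ht1 | <-].
      apply: Rle_trans (Rmax_l _ _); apply: Rlt_le; apply: HT.
      exact: Rle_lt_trans (Rmax_r _ _) Ht1.
    apply: Rle_trans (Rmax_r _ _); apply: Rlt_le; apply: HK; split; last exact: Rle_refl.
    exact: Rmax_l.
  have -> : psi t = psi (Rmax 0 t) by rewrite /psi (Rmax_right 0 (Rmax 0 t)) //; exact: Rmax_l.
  apply: Rle_trans (Rmax_r _ _); apply: Rlt_le; apply: HK; split; first exact: Rmax_l.
  by apply: Rmax_lub; [exact: Rmax_l | lra].
exists (fun t => plus (h t) (psi t)), h; split=> //.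
- split=> [t|]; first by apply: continuous_plus; [exact: (proj1 Hbc) | exact: psic].
  have [C HC] := proj2 Hbc; exists (C + K) => t.
  by apply: Rle_trans (norm_triangle _ _) _; apply: Rplus_le_compat.
- by move=> t t0; rewrite psiE // fE.
- move=> eps He; have [T HT] := psivan eps He.
  by exists T => t Ht; rewrite plus_minus_cancel; exact: HT.
Qed.

(** * Orbits of an exponentially stable semigroup *)

Lemma exp_decay (sigma K eps : R) : 0 < sigma -> 0 <= K -> 0 < eps ->
  exists T, 0 < T /\ forall t, T < t -> exp (- sigma * t) * K < eps.
Proof.
move=> Hs HK He; exists (K / eps / sigma + 1); split.
  have : 0 <= K / eps / sigma by do 2! (apply: Rdiv_le_0_compat => //).
  lra.
move=> t Ht; have -> : - sigma * t = - (sigma * t) by ring.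
rewrite exp_Ropp; have Hexp := exp_ineq1_le (sigma * t).
have Hst : K / eps < sigma * t.
  apply: (Rmult_lt_reg_r (/ sigma)); first exact: Rinv_0_lt_compat.
  by have -> : sigma * t * / sigma = t; [field | rewrite /Rdiv in Ht *]; lra.
have HKe : K = K / eps * eps by field; lra.
apply: (Rmult_lt_reg_l (exp (sigma * t))); first exact: exp_pos.
rewrite -Rmult_assoc Rinv_r; last by have := exp_pos (sigma * t); lra.
rewrite Rmult_1_l {1}HKe; apply: Rmult_lt_compat_r => //; lra.
Qed.

(** The data of the theorem, stripped of the geometry: the kernel bound is any
    integrable function [kappa]. *)
Section Convolution.

Context {X Y : CompleteNormedModule R_AbsRing}.
Variables (E : R -> Y -> Y) (EB : R -> X -> Y) (kappa : R -> R) (M sigma : R).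
Hypothesis E_semigroup : C0_semigroup E.
Hypothesis sigma_gt0 : 0 < sigma.
Hypothesis E_decay : forall t y, 0 < t -> norm (E t y) <= exp (- sigma * t) * norm y.
Hypothesis EB_linear : forall t, 0 < t -> is_linear (EB t).
Hypothesis E_EB : forall r s w, 0 <= r -> 0 < s -> E r (EB s w) = EB (r + s) w.
Hypothesis EB_bound : forall t w, 0 < t -> norm (EB t w) <= kappa t * norm w.
Hypothesis kappa_ge0 : forall t, 0 < t -> 0 <= kappa t.
Hypothesis kappa_continuous : continuous_pos (kappa : R -> R_CompleteNormedModule).
Hypothesis kappa_integral : is_RInt_gen kappa (at_right 0) (Rbar_locally p_infty) M.

Let E_linear : forall t, 0 <= t -> is_linear (E t).
Proof. by case: E_semigroup. Qed.

Let E_zero y : E 0 y = y.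
Proof. by case: E_semigroup => _ []. Qed.

Lemma contraction t y : 0 <= t -> norm (E t y) <= norm y.
Proof.
case/Rle_lt_or_eq => [t0 | <-]; last by rewrite E_zero; lra.
apply: Rle_trans (E_decay t y t0) _; rewrite -{2}(Rmult_1_l (norm y)).
apply: Rmult_le_compat_r; first exact: norm_ge_0.
rewrite -exp_0; apply: Rlt_le; apply: exp_increasing.
by have := Rmult_lt_0_compat _ _ sigma_gt0 t0; lra.
Qed.

(** For s <= t the semigroup law factors out the contraction [E s], so
    right continuity at 0 controls both sides of every time uniformly. *)
Lemma uniformly_continuous_orbit y eps : 0 < eps ->
  exists delta, 0 < delta /\ forall s t, 0 <= s -> 0 <= t -> Rabs (t - s) < delta ->
    norm (minus (E t y) (E s y)) < eps.
Proof.
move=> He; case: E_semigroup => _ [_ [Eadd Eright]].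
have [delta Hdelta] := filterlim_norm_near (Eright y) He.
have Hle s t : 0 <= s -> s <= t -> t - s < delta -> norm (minus (E t y) (E s y)) < eps.
  move=> s0; case/Rle_lt_or_eq => [st | <-] Hd; last first.
    by rewrite /minus plus_opp_r norm_zero.
  have -> : t = s + (t - s) by ring.
  rewrite Eadd //; last by lra.
  rewrite -(linear_minus (E s)); last exact: E_linear.
  apply: Rle_lt_trans (contraction s _ s0) _; apply: Hdelta; last by lra.
  rewrite ball_Rabs /= Rabs_pos_eq; lra.
exists delta; split=> [|s t s0 t0 /Rabs_lt_between Hd]; first exact: cond_pos.
case: (Rle_dec s t) => st; first by apply: Hle => //; lra.
by rewrite norm_minus_sym; apply: Hle => //; lra.
Qed.

(** On the left of [t0] both [w t] and [w t0] are compared with the orbit of [w s]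
    for one fixed earlier time [s] at distance less than the threshold for [k]; the
    orbit is continuous, whereas the continuity of [w] is what is being proved. *)
Lemma continuous_of_cocycle (w : R -> Y) (k : R -> R) (a t0 : R) :
  a <= t0 ->
  (forall eps, 0 < eps -> exists delta, 0 < delta /\ forall r, 0 < r < delta -> k r < eps) ->
  (forall s t, a <= s < t -> norm (minus (w t) (E (t - s) (w s))) <= k (t - s)) ->
  forall eps, 0 < eps -> exists delta, 0 < delta /\
    forall t, a <= t -> Rabs (t - t0) < delta -> norm (minus (w t) (w t0)) < eps.
Proof.
move=> Ha Hk Hw eps He.
have He3 : 0 < eps / 3 by lra.
have [dk [dk0 Hdk]] := Hk _ He3.
have [dr [dr0 Hdr]] := uniformly_continuous_orbit (w t0) _ He3.
have [dl [dl0 Hdl]] : exists dl, 0 < dl /\ forall t, a <= t < t0 -> t0 - t < dl ->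
    norm (minus (w t) (w t0)) < eps.
  case: (Rle_lt_or_eq _ _ Ha) => [at0 | <-]; last by exists 1; split=> [|t]; lra.
  set s := Rmax a (t0 - dk / 2).
  have as_ : a <= s by exact: Rmax_l.
  have st0 : s < t0 by apply: Rmax_lub_lt; lra.
  have ds : t0 - dk / 2 <= s by exact: Rmax_r.
  have [d1 [d10 Hd1]] := uniformly_continuous_orbit (w s) _ He3.
  exists (Rmin d1 (t0 - s)); split=> [|t at_ Htd]; first by apply: Rmin_glb_lt; lra.
  have Htd1 := Rlt_le_trans _ _ _ Htd (Rmin_l _ _).
  have Htd2 := Rlt_le_trans _ _ _ Htd (Rmin_r _ _).
  have n1 := Hw s t ltac:(lra); have n2 := Hw s t0 ltac:(lra).
  have k1 := Hdk (t - s) ltac:(lra); have k2 := Hdk (t0 - s) ltac:(lra).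
  have n3 : norm (minus (E (t - s) (w s)) (E (t0 - s) (w s))) < eps / 3.
    by apply: Hd1; try lra; apply/Rabs_lt_between; lra.
  apply: Rle_lt_trans (norm_minus_triangle _ (E (t - s) (w s)) _) _.
  have := norm_minus_triangle (E (t - s) (w s)) (E (t0 - s) (w s)) (w t0).
  rewrite (norm_minus_sym (E (t0 - s) (w s)) (w t0)); norm_lra.
exists (Rmin dk (Rmin dr dl)); split=> [|t at_ Ht]; first by do 2! apply: Rmin_glb_lt => //.
have Ht1 := Rlt_le_trans _ _ _ Ht (Rmin_l _ _).
have Ht2 := Rlt_le_trans _ _ _ (Rlt_le_trans _ _ _ Ht (Rmin_r _ _)) (Rmin_l _ _).
have Ht3 := Rlt_le_trans _ _ _ (Rlt_le_trans _ _ _ Ht (Rmin_r _ _)) (Rmin_r _ _).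
case: (Rtotal_order t t0) => [tt0 | [-> | tt0]].
- by apply: Hdl => //; move/Rabs_lt_between: Ht3; lra.
- by rewrite /minus plus_opp_r norm_zero.
move/Rabs_lt_between: Ht1 => Ht1.
apply: Rle_lt_trans (norm_minus_triangle _ (E (t - t0) (w t0)) _) _.
have := Hw t0 t ltac:(lra); have := Hdk (t - t0) ltac:(lra).
have := Hdr 0 (t - t0) ltac:(lra) ltac:(lra); rewrite Rminus_0_r E_zero => /(_ Ht2); norm_lra.
Qed.

(** * The mass of the kernel near zero *)

Definition kernel_mass (r : R) : R := RInt_gen kappa (at_right 0) (at_point r).

Lemma is_kernel_mass r : 0 < r ->
  is_RInt_gen kappa (at_right 0) (at_point r) (kernel_mass r).
Proof.
move=> r0.
have [L1 [HL1 _]] := is_RInt_gen_cut (V := R_CompleteNormedModule) kappa M r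
  kappa_continuous r0 kappa_integral.
exact (RInt_gen_correct (V := R_CompleteNormedModule) kappa (ex_intro _ L1 HL1)).
Qed.

Lemma kernel_mass_le r : 0 < r -> kernel_mass r <= M.
Proof.
move=> r0.
have [L1 [HL1 HL2]] := is_RInt_gen_cut (V := R_CompleteNormedModule) kappa M r
  kappa_continuous r0 kappa_integral.
rewrite /kernel_mass (is_RInt_gen_unique (V := R_CompleteNormedModule) _ _ HL1).
have Hnorm : norm (minus M L1 : R_NormedModule) <= minus M L1.
  refine (RInt_gen_norm (V := R_CompleteNormedModule) kappa kappa _ _ _ _ HL2 HL2).
  - exists (fun a => a = r) (fun b => r < b) => // [|a b -> /=]; [exact: p_infty_gt | lra].
  - exists (fun a => a = r) (fun b => r < b) => // [|a b -> /= _ x Hx].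
      exact: p_infty_gt.
    by rewrite /norm /= /abs /= Rabs_pos_eq; [lra | apply: kappa_ge0; lra].
have := Rle_trans _ _ _ (norm_ge_0 _) Hnorm; rewrite /minus /plus /opp /=; lra.
Qed.

Lemma kernel_mass_ge0 r : 0 < r -> 0 <= kernel_mass r.
Proof.
move=> r0; rewrite -(Rmult_1_l (kernel_mass r)).
apply: Rle_trans (norm_ge_0 (kernel_mass r : R_CompleteNormedModule)) _.
apply: (is_RInt_gen_norm_le (V := R_CompleteNormedModule) (at_point r) kappa kappa r) => //;
  try exact: is_kernel_mass; try exact: Rle_refl.
by move=> s Hs; rewrite /norm /= /abs /= Rabs_pos_eq; [lra | apply: kappa_ge0; lra].
Qed.

(** Additivity turns convergence of the integral of [kappa] over (0, 1) into the
    smallness of its integrals over (0, r). *)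
Lemma kernel_mass_small eps : 0 < eps ->
  exists delta, 0 < delta /\ forall r, 0 < r < delta -> kernel_mass r < eps.
Proof.
move=> He.
have [P [Q [[d Pd] FQ HPQ]]] := 
  is_RInt_gen_norm_near (V := R_CompleteNormedModule) (is_kernel_mass 1 Rlt_0_1) He.
exists d; split=> [|r Hr]; first exact: cond_pos.
have Pr : P r.
  apply: Pd; last by lra.
  rewrite ball_Rabs /= Rabs_pos_eq; lra.
have Hch : is_RInt_gen kappa (at_right 0) (at_point 1)
    (plus (kernel_mass r : R_NormedModule) (RInt kappa r 1)).
  apply: (is_RInt_gen_Chasles (V := R_NormedModule)) (is_kernel_mass r (proj1 Hr)) _.
  apply/is_RInt_gen_at_point.
  exact: (is_RInt_pos (V := R_CompleteNormedModule) kappa r 1 kappa_continuous (proj1 Hr) Rlt_0_1).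
have Hsum : kernel_mass 1 = kernel_mass r + RInt kappa r 1.
  exact (is_RInt_gen_unique (V := R_CompleteNormedModule) _ _ Hch).
have := HPQ _ _ Pr FQ; rewrite -/(kernel_mass 1).
rewrite /norm /minus /plus /opp /= /abs /= => /Rabs_lt_between ?; lra.
Qed.

(** * Duhamel integrals and ancient solutions *)

Definition integrand (G : R -> X) (t s : R) : Y := EB s (G (t - s)).

(** The contribution at time [t] of the forcing from t - r to t. *)
Definition duhamel (r : R) (G : R -> X) (t : R) : Y :=
  RInt_gen (integrand G t) (at_right 0) (at_point r).

(** The bounded solution on the whole line, which has no initial time. *)
Definition ancient (G : R -> X) (t : R) : Y :=
  RInt_gen (integrand G t) (at_right 0) (Rbar_locally p_infty).

(** [EB] inherits strong continuity at [s0 > 0] from the semigroup, through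
    EB s = E (s - s1) (EB s1) with s1 = s0 / 2 fixed. *)
Lemma integrand_continuous G t : (forall t, continuous G t) -> continuous_pos (integrand G t).
Proof.
move=> HG s0 s00; set s1 := s0 / 2.
have s10 : 0 < s1 by rewrite /s1; lra.
have s1s0 : s1 < s0 by rewrite /s1; lra.
set z := fun s => EB s1 (G (t - s)).
have Hz : continuous z s0.
  apply: (continuous_comp (fun s => G (t - s)) (EB s1)); last first.
    by apply: linear_cont; exact: EB_linear.
  apply: (continuous_comp (fun s => t - s) G); last exact: HG.
  by apply: (continuous_minus (fun _ => t) (fun s => s)); [apply: continuous_const | apply: continuous_id].
have Hz0 s : s1 < s -> integrand G t s = E (s - s1) (z s).
  by move=> Hs; rewrite /z E_EB; [rewrite /integrand; f_equal; ring | lra | ].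
apply: filterlim_of_norm => eps He.
have He2 : 0 < eps / 2 by lra.
have [d [d0 Hd]] := uniformly_continuous_orbit (z s0) _ He2.
have Hnear := filterlim_norm_near Hz He2.
have Fd : locally s0 (fun s => Rabs (s - s0) < Rmin s1 d).
  have Hm : 0 < Rmin s1 d by apply: Rmin_glb_lt.
  by exists (mkposreal _ Hm).
apply: filter_imp (filter_and _ _ Hnear Fd) => s [Hs Hsd].
have Hsd1 := Rlt_le_trans _ _ _ Hsd (Rmin_l _ _).
have Hsd2 := Rlt_le_trans _ _ _ Hsd (Rmin_r _ _).
have Hs1 : s1 < s by move/Rabs_lt_between: Hsd1; rewrite /s1; lra.
rewrite !Hz0 //.
apply: Rle_lt_trans (norm_minus_triangle _ (E (s - s1) (z s0)) _) _.
have HE : norm (minus (E (s - s1) (z s0)) (E (s0 - s1) (z s0))) < eps / 2.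
  by apply: Hd; [lra | lra | have -> : s - s1 - (s0 - s1) = s - s0 by ring].
rewrite -(linear_minus (E (s - s1))); last by apply: E_linear; lra.
have := contraction (s - s1) (minus (z s) (z s0)) ltac:(lra); norm_lra.
Qed.

Lemma is_ancient G t : bounded_continuous G ->
  is_RInt_gen (integrand G t) (at_right 0) (Rbar_locally p_infty) (ancient G t).
Proof.
move=> [HG [C HC]]; refine (RInt_gen_correct _ _).
apply: (ex_RInt_gen_dominated _ (fun s => C * kappa s) (C * M)).
- exact: integrand_continuous.
- by move=> s Hs; apply: (continuous_scal_r C kappa); exact: kappa_continuous.
- move=> s Hs; apply: Rle_trans (EB_bound _ _ Hs) _.
  by rewrite Rmult_comm; apply: Rmult_le_compat_r; [exact: kappa_ge0 | exact: HC].
- exact: (is_RInt_gen_scal kappa C M kappa_integral).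
Qed.

Lemma is_duhamel r G t : 0 < r -> bounded_continuous G ->
  is_RInt_gen (integrand G t) (at_right 0) (at_point r) (duhamel r G t).
Proof.
move=> r0 HG; refine (RInt_gen_correct _ _).
have [L1 [HL1 _]] := is_RInt_gen_cut _ _ r (integrand_continuous G t (proj1 HG)) r0
  (is_ancient G t HG).
by exists L1.
Qed.

Lemma integrand_le G t s C : 0 < s -> norm (G (t - s)) <= C ->
  norm (integrand G t s) <= C * kappa s.
Proof.
move=> s0 HC; apply: Rle_trans (EB_bound _ _ s0) _.
by rewrite Rmult_comm; apply: Rmult_le_compat_r => //; exact: kappa_ge0.
Qed.

Lemma ancient_le G t C : bounded_continuous G -> (forall s, norm (G s) <= C) ->
  norm (ancient G t) <= C * M.
Proof.
move=> HG HC.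
refine (is_RInt_gen_norm_le (Rbar_locally p_infty) _ kappa 1 C M _ Rlt_0_1 _ _
  (is_ancient G t HG) kappa_integral).
- by exists 1 => b; lra.
- by exists 0 => b _ s [s0 _]; exact: integrand_le.
Qed.

Lemma duhamel_le r G t C : 0 < r -> bounded_continuous G ->
  (forall s, t - r <= s <= t -> norm (G s) <= C) ->
  norm (duhamel r G t) <= C * kernel_mass r.
Proof.
move=> r0 HG HC.
refine (is_RInt_gen_norm_le (at_point r) _ kappa r C _ _ r0 _ _
  (is_duhamel r G t r0 HG) (is_kernel_mass r r0)).
- exact: Rle_refl.
- by move=> s Hs; apply: integrand_le; [lra | apply: HC; lra].
Qed.

Lemma ancient_cocycle r G t : 0 < r -> bounded_continuous G ->
  ancient G t = plus (duhamel r G t) (E r (ancient G (t - r))).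
Proof.
move=> r0 HG; refine (is_RInt_gen_unique _ _ _).
refine (is_RInt_gen_shift (Rbar_locally p_infty) (Rbar_locally p_infty)
  (integrand G (t - r)) (integrand G t) (E r) r _ _ _ _ _ _ _ _ _ _ _).
- exact: integrand_continuous (proj1 HG).
- exact: integrand_continuous (proj1 HG).
- by apply: E_linear; lra.
- done.
- by move=> s s0; rewrite /integrand E_EB; [f_equal; f_equal; ring | lra | ].
- done.
- by move=> P [A HA]; exists (A + r) => b Hb; apply: HA; lra.
- exact: is_ancient.
- exact: is_duhamel.
Qed.

Lemma duhamel_cocycle r rho G t : 0 < r -> 0 < rho -> bounded_continuous G ->
  duhamel (r + rho) G t = plus (duhamel r G t) (E r (duhamel rho G (t - r))).
Proof.
move=> r0 rho0 HG; refine (is_RInt_gen_unique _ _ _).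
refine (is_RInt_gen_shift (at_point rho) (at_point (r + rho))
  (integrand G (t - r)) (integrand G t) (E r) r _ _ _ _ _ _ _ _ _ _ _).
- exact: integrand_continuous (proj1 HG).
- exact: integrand_continuous (proj1 HG).
- by apply: E_linear; lra.
- done.
- by move=> s s0; rewrite /integrand E_EB; [f_equal; f_equal; ring | lra | ].
- done.
- by move=> P HP; rewrite /filtermap /at_point (_ : r + rho - r = rho) //; ring.
- exact: is_duhamel.
- exact: is_duhamel.
Qed.

Lemma integrand_minus G H t s : 0 < s ->
  integrand (fun x => minus (G x) (H x)) t s = minus (integrand G t s) (integrand H t s).
Proof. by move=> s0; rewrite /integrand (linear_minus (EB s)) //; exact: EB_linear. Qed.

Lemma ancient_minus G H t : bounded_continuous G -> bounded_continuous H ->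
  ancient (fun x => minus (G x) (H x)) t = minus (ancient G t) (ancient H t).
Proof.
move=> HG HH; refine (is_RInt_gen_unique _ _ _).
refine (is_RInt_gen_ext _ _ _ _
  (is_RInt_gen_minus _ _ _ _ (is_ancient G t HG) (is_ancient H t HH))).
exists (fun a => 0 < a) (fun b => 0 < b) => // a b /= a0 b0 x [Hx _].
rewrite integrand_minus //; apply: Rlt_trans Hx; exact: Rmin_glb_lt.
Qed.

Lemma duhamel_minus r G H t : 0 < r -> bounded_continuous G -> bounded_continuous H ->
  duhamel r (fun x => minus (G x) (H x)) t = minus (duhamel r G t) (duhamel r H t).
Proof.
move=> r0 HG HH; refine (is_RInt_gen_unique _ _ _).
refine (is_RInt_gen_ext _ _ _ _
  (is_RInt_gen_minus _ _ _ _ (is_duhamel r G t r0 HG) (is_duhamel r H t r0 HH))).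
exists (fun a => 0 < a) (fun b => 0 < b) => // a b /= a0 b0 x [Hx _].
rewrite integrand_minus //; apply: Rlt_trans Hx; exact: Rmin_glb_lt.
Qed.

Lemma ancient_translate G T t : ancient (fun x => G (x + T)) t = ancient G (t + T).
Proof.
congr (RInt_gen _ _ _); apply: functional_extensionality => s.
by rewrite /integrand; congr (EB s (G _)); ring.
Qed.

Lemma mass_bound_small C eps : 0 <= C -> 0 < eps ->
  exists delta, 0 < delta /\ forall r, 0 < r < delta -> C * kernel_mass r < eps.
Proof.
move=> HC He; have HeC : 0 < eps / (C + 1) by apply: Rdiv_lt_0_compat; lra.
have [d [d0 Hd]] := kernel_mass_small _ HeC.
exists d; split=> // r Hr; have m0 := kernel_mass_ge0 r (proj1 Hr).
have : (C + 1) * kernel_mass r < (C + 1) * (eps / (C + 1)).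
  by apply: Rmult_lt_compat_l; [lra | exact: Hd].
have -> : (C + 1) * (eps / (C + 1)) = eps by field; lra.
lra.
Qed.

Lemma M_ge0 : 0 <= M.
Proof. by have := kernel_mass_ge0 1 Rlt_0_1; have := kernel_mass_le 1 Rlt_0_1; lra. Qed.

(** The identity is applied from time [t0 - 1] on, only to have room on the left of
    [t0]. *)
Lemma ancient_continuous G t0 : bounded_continuous G -> continuous (ancient G) t0.
Proof.
move=> HG; have [_ [C HC]] := HG.
apply: filterlim_of_norm => eps He.
have Ht0 : t0 - 1 <= t0 by lra.
have [|d [d0 Hd]] := continuous_of_cocycle (ancient G) (fun r => C * kernel_mass r)
  (t0 - 1) t0 Ht0 (fun e => mass_bound_small C e (bound_ge0 G C HC)) _ eps He.
  move=> s t Hst; have r0 : 0 < t - s by lra.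
  rewrite (ancient_cocycle _ _ _ r0 HG).
  have -> : t - (t - s) = s by ring.
  by rewrite plus_comm plus_minus_cancel; apply: duhamel_le.
have Hm : 0 < Rmin 1 d by apply: Rmin_glb_lt; lra.
exists (mkposreal _ Hm) => t.
rewrite ball_Rabs /= => Ht.
have H1 := Rlt_le_trans _ _ _ Ht (Rmin_l _ _).
apply: Hd; last exact: Rlt_le_trans Ht (Rmin_r _ _).
by move/Rabs_lt_between: H1; lra.
Qed.

(** Linearity and translation equivariance: J(t + T) - J(t) is the ancient solution
    driven by h(. + T) - h. *)
Lemma AP_ancient h : AP h -> AP (ancient h).
Proof.
move=> [[hcont hbound] hper].
have Hh : bounded_continuous h.
  split; first exact/continuous_on_Rall.
  by have [C HC] := hbound; exists C => t; exact: HC.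
have [C HC] := proj2 Hh.
split.
  split; last by exists (C * M) => t _; exact: ancient_le.
  by apply/continuous_on_Rall => t; exact: ancient_continuous.
move=> eps He; have HM := M_ge0.
(* M + 1 rather than M, which may be 0. *)
have He1 : 0 < eps / (M + 1) by apply: Rdiv_lt_0_compat; lra.
have [l [l0 Hl]] := hper _ He1.
exists l; split=> // a; have [T [HT Hsup]] := Hl a.
exists T; split=> //.
have HhT : bounded_continuous (fun t => h (t + T)).
  split=> [t|]; last by exists C => t; exact: HC.
  apply: (continuous_comp (fun t => t + T) h); last exact: (proj1 Hh).
  by apply: (continuous_plus (fun t => t) (fun _ => T)); [apply: continuous_id | apply: continuous_const].
set m := real (sup_norm Rall_set (fun t => minus (h (t + T)) (h t))).
have Hm t : norm (minus (h (t + T)) (h t)) <= m /\ m < eps / (M + 1).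
  have := norm_le_sup_norm Rall_set (fun t => minus (h (t + T)) (h t)) t I.
  by move: Hsup; rewrite /m; case: (sup_norm _ _).
apply: (Rbar_le_lt_trans _ (m * M)).
  apply: sup_norm_le => t _; rewrite -ancient_translate -ancient_minus //.
  by apply: ancient_le => [|s]; [exact: bounded_continuous_minus | exact: (proj1 (Hm s))].
have m0 : 0 <= m by have := norm_ge_0 (minus (h (0 + T)) (h 0)); have := proj1 (Hm 0); norm_lra.
have : m * (M + 1) < eps / (M + 1) * (M + 1).
  by apply: Rmult_lt_compat_r; [lra | exact: (proj2 (Hm 0))].
have -> : eps / (M + 1) * (M + 1) = eps by field; lra.
rewrite /=; lra.
Qed.

(** Splitting the memory at [t / 2]: the recent half sees only small values of [G],
    and the older half, bounded by [C * M], is damped by [E (t / 2)]. *)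
Lemma duhamel_vanishing G : bounded_continuous G -> vanishing G ->
  vanishing (fun t => duhamel t G t).
Proof.
move=> HG Gvan eps He; have HM := M_ge0; have [_ [C HC]] := HG.
have He1 : 0 < eps / 2 / (M + 1) by apply: Rdiv_lt_0_compat; lra.
have He2 : 0 < eps / 2 by lra.
have [T1 HT1] := Gvan _ He1.
have CM : 0 <= C * M by apply: Rmult_le_pos => //; exact: bound_ge0 HC.
have [T2 [T20 HT2]] := exp_decay sigma (C * M) _ sigma_gt0 CM He2.
exists (2 * (Rabs T1 + T2)) => t Ht; set r := t / 2.
have T1a := Rle_abs T1; have a0 := Rabs_pos T1.
have r0 : 0 < r by rewrite /r; lra.
have rT1 : T1 < r by rewrite /r; lra.
have rT2 : T2 < r by rewrite /r; lra.
have {1}-> : t = r + r by rewrite /r; field.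
rewrite duhamel_cocycle //.
have H1 : norm (duhamel r G t) <= eps / 2 / (M + 1) * kernel_mass r.
  apply: duhamel_le => // s Hs; apply: Rlt_le; apply: HT1.
  by move: Hs; rewrite /r; rewrite /r in rT1; lra.
have H2 : eps / 2 / (M + 1) * kernel_mass r <= eps / 2.
  have -> : eps / 2 = eps / 2 / (M + 1) * (M + 1) by field; lra.
  have -> : eps / 2 / (M + 1) * (M + 1) / (M + 1) = eps / 2 / (M + 1) by field; lra.
  apply: Rmult_le_compat_l; first lra; have := kernel_mass_le r r0; lra.
have H3 : norm (E r (duhamel r G (t - r))) < eps / 2.
  apply: Rle_lt_trans (E_decay _ _ r0) _; apply: Rle_lt_trans (HT2 r rT2).
  apply: Rmult_le_compat_l; first by apply: Rlt_le; exact: exp_pos.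
  apply: Rle_trans (duhamel_le r G (t - r) C r0 HG (fun s _ => HC s)) _.
  by apply: Rmult_le_compat_l; [exact: bound_ge0 HC | exact: kernel_mass_le].
apply: Rle_lt_trans (norm_triangle _ _) _; lra.
Qed.

(** * Mild solutions *)

(** The case distinction is needed because the improper integral over an
    interval reduced to 0 need not converge. *)
Definition forward (u0 : Y) (G : R -> X) (t : R) : Y :=
  if Rlt_dec 0 t then plus (E t u0) (duhamel t G t) else u0.

Lemma forward_pos u0 G t : 0 < t -> forward u0 G t = plus (E t u0) (duhamel t G t).
Proof. by rewrite /forward; case: Rlt_dec. Qed.

Lemma forward_0 u0 G : forward u0 G 0 = u0.
Proof. by rewrite /forward; case: Rlt_dec => // H; case: (Rlt_irrefl 0). Qed.

Lemma forward_cocycle u0 G s t : bounded_continuous G -> 0 <= s < t ->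
  forward u0 G t = plus (E (t - s) (forward u0 G s)) (duhamel (t - s) G t).
Proof.
move=> HG [s0 st]; rewrite (forward_pos _ _ t); last by lra.
case: (Rle_lt_or_eq _ _ s0) => [{}s0 | <-]; last by rewrite forward_0 Rminus_0_r.
have r0 : 0 < t - s by lra.
rewrite forward_pos // (linear_plus (E (t - s))); last by apply: E_linear; lra.
case: E_semigroup => _ [_ [Eadd _]]; rewrite -Eadd; try lra.
have -> : t - s + s = t by ring.
rewrite -plus_assoc; congr (plus _ _).
have {1}-> : t = (t - s) + s by ring.
rewrite duhamel_cocycle // plus_comm.
by have -> : t - (t - s) = s by ring.
Qed.

Lemma forward_continuous u0 G : bounded_continuous G ->
  continuous_on Rplus_set (forward u0 G).
Proof.
move=> HG t0 Ht0; have [_ [C HC]] := HG.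
apply: filterlim_of_norm => eps He.
have [|d [d0 Hd]] := continuous_of_cocycle (forward u0 G) (fun r => C * kernel_mass r)
  0 t0 Ht0 (fun e => mass_bound_small C e (bound_ge0 G C HC)) _ eps He.
  move=> s t Hst; rewrite (forward_cocycle u0 G s t) // plus_minus_cancel.
  by apply: duhamel_le => //; lra.
exists (mkposreal _ d0) => t.
rewrite ball_Rabs /= => Ht t_ge0.
exact: Hd.
Qed.

Lemma forward_le u0 G t F : bounded_continuous G -> 0 <= t ->
  (forall s, 0 <= s -> norm (G s) <= F) -> norm (forward u0 G t) <= norm u0 + M * F.
Proof.
move=> HG; have F0 : (forall s, 0 <= s -> norm (G s) <= F) -> 0 <= F.
  by move=> HF; apply: Rle_trans (norm_ge_0 (G 0)) (HF 0 _); lra.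
case/Rle_lt_or_eq => [t0 | <-] HF; have {}F0 := F0 HF; last first.
  by rewrite forward_0; have := Rmult_le_pos _ _ M_ge0 F0; lra.
rewrite forward_pos //; apply: Rle_trans (norm_triangle _ _) _.
have H1 := contraction t u0 (Rlt_le _ _ t0).
have H2 : norm (duhamel t G t) <= F * kernel_mass t.
  by apply: duhamel_le => // s Hs; apply: HF; lra.
have := Rmult_le_compat_l F _ _ F0 (kernel_mass_le t t0); lra.
Qed.

(** With r = t the cocycle identity writes J(t) as a solution with initial value
    J(0), so the difference is a solution with forcing [G - h]. *)
Lemma forward_minus_ancient u0 G h t : 0 < t ->
  bounded_continuous G -> bounded_continuous h ->
  minus (forward u0 G t) (ancient h t) =
  plus (E t (minus u0 (ancient h 0))) (duhamel t (fun s => minus (G s) (h s)) t).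
Proof.
move=> t0 HG Hh; rewrite forward_pos // (ancient_cocycle t) // duhamel_minus //.
rewrite (linear_minus (E t)); last by apply: E_linear; lra.
have -> : t - t = 0 by ring.
rewrite /minus opp_plus -!plus_assoc; congr (plus _ _).
by rewrite (plus_comm (opp (duhamel t h t))) !plus_assoc (plus_comm (duhamel t G t)).
Qed.

Lemma forward_asymptotic u0 G h : bounded_continuous G -> bounded_continuous h ->
  vanishing (fun t => minus (G t) (h t)) ->
  vanishing (fun t => minus (forward u0 G t) (ancient h t)).
Proof.
move=> HG Hh Hvan eps He; have He2 : 0 < eps / 2 by lra.
have [T1 HT1] := duhamel_vanishing _ (bounded_continuous_minus _ _ HG Hh) Hvan _ He2.
have [T2 [T20 HT2]] := exp_decay sigma (norm (minus u0 (ancient h 0))) _ sigma_gt0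
  (norm_ge_0 _) He2.
exists (Rmax T1 T2) => t Ht.
have t1 := Rle_lt_trans _ _ _ (Rmax_l _ _) Ht.
have t2 := Rle_lt_trans _ _ _ (Rmax_r _ _) Ht.
have t0 : 0 < t by lra.
rewrite forward_minus_ancient //; apply: Rle_lt_trans (norm_triangle _ _) _.
have H1 := HT1 t t1; have H2 := HT2 t t2.
have H3 := E_decay t (minus u0 (ancient h 0)) t0.
norm_lra.
Qed.

(** The substitution tau = t - s exchanges the limit s -> 0 from the right with
    tau -> t from the left and reverses orientation. *)
Lemma duhamel_mild_integral f G t : bounded_continuous G ->
  (forall s, 0 <= s -> f s = G s) -> 0 < t ->
  is_RInt_gen (fun tau => EB (t - tau) (f tau)) (at_point 0) (at_left t) (duhamel t G t).
Proof.
move=> HG fG t0 P HP.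
have [A Q [d Hd] FQ HAQ] := is_duhamel t G t t0 HG P HP.
have Hm : 0 < Rmin d t by apply: Rmin_glb_lt => //; exact: cond_pos.
exists (fun a => a = 0) (fun b => 0 < t - b < d /\ 0 < b) => //.
  exists (mkposreal _ Hm) => b.
  rewrite ball_Rabs /= => Hb bt.
  have H1 := Rlt_le_trans _ _ _ Hb (Rmin_l _ _).
  have H2 := Rlt_le_trans _ _ _ Hb (Rmin_r _ _).
  by move/Rabs_lt_between: H1; move/Rabs_lt_between: H2; lra.
move=> _ b -> [Hb b0] /=.
have [|y [Hy Py]] := HAQ (t - b) t _ FQ.
  apply: Hd; last by lra.
  rewrite ball_Rabs /= Rabs_pos_eq; lra.
exists y; split=> //.
have Hsubst : is_RInt (fun tau => scal (-1) (integrand G t (-1 * tau + t))) 0 b (opp y).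
  apply: is_RInt_comp_lin.
  have -> : -1 * 0 + t = t by ring.
  have -> : -1 * b + t = t - b by ring.
  exact: is_RInt_swap.
rewrite -(opp_opp y); apply: is_RInt_ext (is_RInt_opp _ _ _ _ Hsubst) => tau Htau.
rewrite (scal_opp_one (K := R_Ring)) opp_opp /integrand.
have -> : -1 * tau + t = t - tau by ring.
have -> : t - (t - tau) = tau by ring.
rewrite fG //; move: Htau; rewrite Rmin_left; lra.
Qed.

Lemma forward_mild u0 f G : bounded_continuous G -> (forall s, 0 <= s -> f s = G s) ->
  mild_solution E EB u0 f (forward u0 G).
Proof.
move=> HG fG; split=> [|t t0]; first by rewrite forward_0 E_zero.
exists (duhamel t G t); split; last exact: forward_pos.
exact: duhamel_mild_integral.
Qed.

Lemma mild_unique u0 f u v : mild_solution E EB u0 f u -> mild_solution E EB u0 f v ->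
  forall t, 0 <= t -> v t = u t.
Proof.
move=> [u_0 Hu] [v_0 Hv] t; case/Rle_lt_or_eq => [t0 | <-]; last by rewrite u_0 v_0.
have [J [HJ ->]] := Hu t t0; have [J' [HJ' ->]] := Hv t t0.
by rewrite -(is_RInt_gen_unique _ _ HJ) -(is_RInt_gen_unique _ _ HJ').
Qed.

Lemma AAP_forward u0 G h : AP h -> bounded_continuous G -> bounded_continuous h ->
  vanishing (fun t => minus (G t) (h t)) -> AAP (forward u0 G).
Proof.
move=> hAP HG Hh Hvan; have ucont := forward_continuous u0 G HG.
split=> //; exists (ancient h), (fun t => minus (forward u0 G t) (ancient h t)).
split; [exact: AP_ancient | split].
- split.
    move=> t t_ge0.
    refine (filterlim_comp_2 _ _ _ (ucont t t_ge0)
      (filterlim_comp _ _ _ _ _ _ _ _ _ (filterlim_opp (ancient h t)))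
      (filterlim_plus (forward u0 G t) (opp (ancient h t)))).
    have Hanc := ancient_continuous h t Hh.
    by move=> P HP; have [d Hd] := Hanc P HP; exists d => s Hs _; exact: Hd s Hs.
  apply/is_lim_spec => eps.
  have [T HT] := forward_asymptotic u0 G h HG Hh Hvan eps (cond_pos eps).
  exists T => t Ht; rewrite Rminus_0_r Rabs_pos_eq; [exact: HT | exact: norm_ge_0].
- by move=> t _; rewrite /minus (plus_comm (forward u0 G t)) plus_assoc plus_opp_r plus_zero_l.
Qed.

Lemma AAP_mild_solution u0 f : AAP f ->
  exists u, (AAP u /\ mild_solution E EB u0 f u) /\
    (forall v, AAP v /\ mild_solution E EB u0 f v -> forall t, 0 <= t -> v t = u t) /\
    Rbar_le (sup_norm Rplus_set u)
            (Rbar_plus (norm u0) (Rbar_mult M (sup_norm Rplus_set f))).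
Proof.
move=> /AAP_extend [G [h [hAP HG Hh fG Hvan]]].
have umild := forward_mild u0 f G HG fG.
exists (forward u0 G); split; [split=> // | split].
- exact: AAP_forward Hvan.
- by move=> v [_ vmild]; exact: mild_unique umild vmild.
have [F HF] : exists F : R, sup_norm Rplus_set f = F.
  have [_ [C HC]] := HG.
  have H0 := norm_le_sup_norm Rplus_set f 0 (Rle_refl 0).
  have HCf : Rbar_le (sup_norm Rplus_set f) C.
    by apply: sup_norm_le => t t_ge0; rewrite fG //; exact: HC.
  by move: H0 HCf; case: (sup_norm _ _) => [r| |] //; exists r.
rewrite HF; apply: sup_norm_le => t t_ge0; apply: forward_le => // s s_ge0.
by have := norm_le_sup_norm Rplus_set f s s_ge0; rewrite HF -fG.
Qed.

End Convolution.

(** * Composition of the semigroup with an unbounded operator *)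

Lemma linear_eq_dense {X Y : NormedModule R_AbsRing} (D : X -> Prop) (l1 l2 : X -> Y) :
  is_linear l1 -> is_linear l2 ->
  (forall w eps, 0 < eps -> exists w', D w' /\ norm (minus w' w) < eps) ->
  (forall w, D w -> l1 w = l2 w) -> forall w, l1 w = l2 w.
Proof.
move=> Hl1 Hl2 Hdense Heq w.
have [A1 [A10 HA1]] := linear_norm l1 Hl1; have [A2 [A20 HA2]] := linear_norm l2 Hl2.
suff H0 : norm (minus (l1 w) (l2 w)) <= 0.
  have /norm_eq_zero H : norm (minus (l1 w) (l2 w)) = 0 by have := norm_ge_0 (minus (l1 w) (l2 w)); lra.
  by rewrite -(plus_zero_r (l2 w)) -H /minus (plus_comm (l1 w)) plus_assoc plus_opp_r plus_zero_l.
apply: le_epsilon => eps He; rewrite Rplus_0_l.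
have HeA : 0 < eps / (A1 + A2) by apply: Rdiv_lt_0_compat; lra.
have [w' [Dw' Hw']] := Hdense w _ HeA.
apply: Rle_trans (norm_minus_triangle _ (l1 w') _) _.
rewrite {2}(Heq w') // -(linear_minus l1) // -(linear_minus l2) //.
have := HA1 (minus w w'); have := HA2 (minus w' w); rewrite (norm_minus_sym w w').
have -> : eps = (A1 + A2) * (eps / (A1 + A2)) by field; lra.
move/Rlt_le: Hw' => Hw'.
have := Rmult_le_compat_l (A1 + A2) _ _ _ Hw'; lra.
Qed.

Lemma semigroup_composition {X Y : CompleteNormedModule R_AbsRing} (E : R -> Y -> Y)
  (D : X -> Prop) (B : X -> Y) (EB : R -> X -> Y) r s w :
  C0_semigroup E -> densely_defined_linear D B -> bounded_composition E D B EB ->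
  0 <= r -> 0 < s -> E r (EB s w) = EB (r + s) w.
Proof.
move=> [E_linear [_ [Eadd _]]] [_ [_ [_ Ddense]]] HEB r0 s0.
have [lin_s EB_s] := HEB s s0; have [lin_rs EB_rs] := HEB (r + s) ltac:(lra).
apply: (linear_eq_dense D (fun w => E r (EB s w)) (EB (r + s))) => //.
- by apply: is_linear_comp => //; exact: E_linear.
- by move=> w' Dw'; rewrite EB_s // EB_rs // Eadd //; lra.
Qed.

(** * The integral of the heat kernel bound *)

Lemma is_RInt_gen_primitive (F g : R -> R) (la lb : R) :
  (forall s, 0 < s -> is_derive F s (g s)) ->
  continuous_pos (g : R -> R_CompleteNormedModule) ->
  filterlim F (at_right 0) (locally la) ->
  filterlim F (Rbar_locally p_infty) (locally lb) ->
  is_RInt_gen g (at_right 0) (Rbar_locally p_infty) (lb - la).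
Proof.
move=> Fg Hg Hla Hlb.
apply: (is_RInt_gen_of_norm (V := R_CompleteNormedModule)) => // eps He.
have He2 : 0 < eps / 2 by lra.
have Pa := filterlim_norm_near (V := R_NormedModule) Hla He2.
have Pb := filterlim_norm_near (V := R_NormedModule) Hlb He2.
exists (fun a => norm (minus (F a) la : R_NormedModule) < eps / 2 /\ 0 < a),
  (fun b => norm (minus (F b) lb : R_NormedModule) < eps / 2 /\ 0 < b).
split; try exact: filter_and.
move=> a b [Ha a0] [Hb b0].
have -> : RInt g a b = F b - F a.
  apply: is_RInt_unique; apply: (is_RInt_derive F g) => z [Hz _].
    by apply: Fg; apply: Rlt_le_trans Hz; exact: Rmin_glb_lt.
  by apply: Hg; apply: Rlt_le_trans Hz; exact: Rmin_glb_lt.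
move: Ha Hb; rewrite /norm /minus /plus /opp /= /abs /=.
by move=> /Rabs_lt_between ? /Rabs_lt_between ?; apply/Rabs_lt_between; lra.
Qed.

Lemma is_RInt_gen_dilate (f : R -> R) (b l : R) : 0 < b ->
  continuous_pos (f : R -> R_CompleteNormedModule) ->
  is_RInt_gen f (at_right 0) (Rbar_locally p_infty) l ->
  is_RInt_gen (fun s => b * f (b * s)) (at_right 0) (Rbar_locally p_infty) l.
Proof.
move=> b0 Hf Hl P HP; have [A Q [d Hd] [T HT] HAQ] := Hl P HP.
have Hm : 0 < d / b by apply: Rdiv_lt_0_compat => //; exact: cond_pos.
exists (fun a => A (b * a)) (fun c => Q (b * c)).
- exists (mkposreal _ Hm) => y.
  rewrite ball_Rabs /= => /Rabs_lt_between Hy y0.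
  apply: Hd; last exact: Rmult_lt_0_compat.
  have by_d : b * y < d.
    have -> : pos d = b * (d / b) by field; lra.
    by apply: Rmult_lt_compat_l => //; lra.
  rewrite ball_Rabs /= Rabs_pos_eq; first lra.
  by have := Rmult_lt_0_compat _ _ b0 y0; lra.
- exists (T / b) => c Hc; apply: HT.
  have -> : T = b * (T / b) by field; lra.
  exact: Rmult_lt_compat_l.
- move=> a c /= Aa Qc; have [y [Hy Py]] := HAQ _ _ Aa Qc.
  exists y; split=> //.
  apply: (is_RInt_ext (fun s => scal b (f (b * s + 0)))).
    by move=> s _; rewrite Rplus_0_r.
  by apply: (is_RInt_comp_lin f b 0); rewrite !Rplus_0_r.
Qed.

Lemma exp_Ropp_lim : filterlim (fun t => exp (- t)) (Rbar_locally p_infty) (locally 0).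
Proof.
apply: (filterlim_of_norm (V := R_NormedModule)) => eps He.
have [T [T0 HT]] := exp_decay 1 1 eps Rlt_0_1 (Rlt_le _ _ Rlt_0_1) He.
exists T => t Ht; have := HT t Ht; rewrite /norm /minus /plus /opp /= /abs /=.
have -> : - (1) * t = - t by ring.
rewrite Rabs_pos_eq; first lra.
by have := exp_pos (- t); lra.
Qed.

Lemma one_sub_exp_bounds t : 0 < t -> 0 < 1 - exp (- t) <= t.
Proof.
move=> t0; have := exp_ineq1_le (- t); have := exp_increasing (- t) 0.
by rewrite exp_0; lra.
Qed.

Lemma Rpower_small x eps : 0 < x -> 0 < eps ->
  exists delta, 0 < delta /\ forall y, 0 < y < delta -> Rpower y x < eps.
Proof.
move=> x0 He; exists (Rpower eps (/ x)); split; first exact: exp_pos.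
move=> y Hy; have -> : eps = Rpower (Rpower eps (/ x)) x.
  by rewrite Rpower_mult Rinv_l ?Rpower_1 //; lra.
exact: Rlt_Rpower_l.
Qed.

(** Since 1 - e^(-t) <= t and x <= 1, the integrand is dominated on the whole
    half-line by (1 - e^(-t))^(x - 1) e^(-t), which has the bounded primitive
    (1 - e^(-t))^x / x.  This settles both ends at once. *)
Lemma is_Gamma x : 0 < x <= 1 ->
  is_RInt_gen (fun t => Rpower t (x - 1) * exp (- t)) (at_right 0) (Rbar_locally p_infty)
    (Gamma x).
Proof.
move=> [x0 x1]; refine (RInt_gen_correct (V := R_CompleteNormedModule) _ _).
set g := fun t => Rpower (1 - exp (- t)) (x - 1) * exp (- t).
set F := fun t => Rpower (1 - exp (- t)) x / x.
have Fg s : 0 < s -> is_derive F s (g s).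
  move=> s0; have e0 := proj1 (one_sub_exp_bounds s s0).
  rewrite /F /g /Rpower; auto_derive; first lra.
  have -> : exp ((x - 1) * ln (1 - exp (- s))) =
      exp (x * ln (1 - exp (- s))) / (1 - exp (- s)).
    have -> : (x - 1) * ln (1 - exp (- s)) =
      x * ln (1 - exp (- s)) + - ln (1 - exp (- s)) by ring.
    by rewrite exp_plus (exp_Ropp (ln _)) exp_ln.
  rewrite -/(1 - exp (- s)); field; lra.
have gcont : continuous_pos (g : R -> R_CompleteNormedModule).
  move=> s s0; have e0 := proj1 (one_sub_exp_bounds s s0).
  apply: (ex_derive_continuous (V := R_NormedModule)).
  by rewrite /g /Rpower; auto_derive; lra.
apply: (ex_RInt_gen_dominated (V := R_CompleteNormedModule) _ g (/ x - 0)) => //.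
- move=> s s0; apply: (ex_derive_continuous (V := R_NormedModule)).
  by rewrite /Rpower; auto_derive; lra.
- move=> s s0; have [e0 es] := one_sub_exp_bounds s s0.
  rewrite /norm /= /abs /= Rabs_pos_eq; last first.
    by apply: Rmult_le_pos; apply: Rlt_le; exact: exp_pos.
  apply: Rmult_le_compat_r; first by apply: Rlt_le; exact: exp_pos.
  have -> : x - 1 = - (1 - x) by ring.
  rewrite !Rpower_Ropp; apply: Rinv_le_contravar; first exact: exp_pos.
  by apply: Rle_Rpower_l; lra.
apply: (is_RInt_gen_primitive F) => //.
- apply: (filterlim_of_norm (V := R_NormedModule)) => eps He.
  have Hex : 0 < eps * x by exact: Rmult_lt_0_compat.
  have [d [d0 Hd]] := Rpower_small x _ x0 Hex.
  exists (mkposreal d d0) => t.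
  rewrite ball_Rabs /norm /minus /plus /opp /= /abs /= => /Rabs_lt_between Ht t0.
  have Hb := one_sub_exp_bounds t t0.
  have := Hd (1 - exp (- t)) ltac:(lra).
  have F0 : 0 < F t by apply: Rdiv_lt_0_compat => //; exact: exp_pos.
  have FE : F t * x = Rpower (1 - exp (- t)) x by rewrite /F; field; lra.
  rewrite -FE => /(Rmult_lt_reg_r _ _ _ x0) HF.
  by rewrite Rabs_pos_eq; lra.
- apply: (filterlim_comp _ _ _ (fun t => exp (- t)) (fun e => Rpower (1 - e) x / x)).
    exact: exp_Ropp_lim.
  have -> : / x = Rpower (1 - 0) x / x.
    by rewrite Rminus_0_r /Rpower ln_1 Rmult_0_r exp_0; field; lra.
  apply: (ex_derive_continuous (V := R_NormedModule) (fun e => Rpower (1 - e) x / x)).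
  by rewrite /Rpower; auto_derive; lra.
Qed.

Lemma exp_integral b : 0 < b ->
  is_RInt_gen (fun s => exp (- b * s)) (at_right 0) (Rbar_locally p_infty) (/ b).
Proof.
move=> b0.
have H : is_RInt_gen (fun t => exp (- t)) (at_right 0) (Rbar_locally p_infty) (0 - (- 1)).
  apply: (is_RInt_gen_primitive (fun t => - exp (- t))).
  - by move=> s _; auto_derive => //; ring.
  - move=> s _; apply: (ex_derive_continuous (V := R_NormedModule)); by auto_derive.
  - apply: (filterlim_filter_le_1 (F := locally 0)) => [P [d Hd]|].
      by exists d => y Hy _; exact: Hd.
    have -> : -1 = - exp (- 0) by rewrite Ropp_0 exp_0.
    apply: (ex_derive_continuous (V := R_NormedModule) (fun t => - exp (- t))); by auto_derive.
  - have -> : 0 = - 0 by ring.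
    apply: filterlim_comp exp_Ropp_lim _.
    apply: (ex_derive_continuous (V := R_NormedModule) Ropp); by auto_derive.
have Hcont : continuous_pos ((fun t => exp (- t)) : R -> R_CompleteNormedModule).
  by move=> s _; apply: (ex_derive_continuous (V := R_NormedModule)); auto_derive.
have -> : / b = scal (/ b) (0 - -1) by rewrite /scal /= /mult /=; ring.
refine (is_RInt_gen_ext _ _ _ _
  (is_RInt_gen_scal _ (/ b) _ (is_RInt_gen_dilate _ b _ b0 Hcont H))).
exists (fun _ => True) (fun _ => True); try exact: filter_true.
move=> x y _ _ s _; rewrite /scal /= /mult /=.
have -> : - b * s = - (b * s) by ring.
by field; lra.
Qed.

Definition heat_kernel (alpha theta beta t : R) : R :=
  alpha * (Rpower t (- theta) + 1) * exp (- beta * t).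

(** Dilating the Gamma integral by [beta] produces beta^(1 - theta) s^(-theta),
    whence the factor beta^(theta - 1). *)
Lemma heat_kernel_integral alpha theta beta : 0 <= theta < 1 -> 0 < beta ->
  is_RInt_gen (heat_kernel alpha theta beta) (at_right 0) (Rbar_locally p_infty)
    (alpha * (Rpower beta (theta - 1) * Gamma (1 - theta) + / beta)).
Proof.
move=> Ht b0.
have Hcont : continuous_pos
    ((fun t => Rpower t (1 - theta - 1) * exp (- t)) : R -> R_CompleteNormedModule).
  move=> s s0; apply: (ex_derive_continuous (V := R_NormedModule)).
  by rewrite /Rpower; auto_derive; lra.
have HG := is_RInt_gen_dilate _ _ _ b0 Hcont (is_Gamma (1 - theta) ltac:(lra)).
refine (is_RInt_gen_ext _ _ _ _ (is_RInt_gen_scal _ alpha _ (is_RInt_gen_plus _ _ _ _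
  (is_RInt_gen_scal _ (Rpower beta (theta - 1)) _ HG) (exp_integral beta b0)))).
exists (fun a => 0 < a) (fun b => 0 < b) => // a b a0 b0' s [/= Hs _].
have s0 : 0 < s by apply: Rlt_trans Hs; exact: Rmin_glb_lt.
rewrite /heat_kernel /scal /plus /= /mult /=.
have -> : 1 - theta - 1 = - theta by ring.
have -> : - beta * s = - (beta * s) by ring.
rewrite -(Rpower_mult_distr beta s) //.
have -> : Rpower beta (theta - 1) = Rpower beta theta / beta.
  by rewrite Rpower_plus Rpower_Ropp Rpower_1.
rewrite (Rpower_Ropp beta); have := exp_pos (theta * ln beta); rewrite -/(Rpower beta theta) => bt.
by field; split; lra.
Qed.

Lemma heat_kernel_continuous alpha theta beta :
  continuous_pos (heat_kernel alpha theta beta : R -> R_CompleteNormedModule).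
Proof.
move=> s s0; apply: (ex_derive_continuous (V := R_NormedModule)).
by rewrite /heat_kernel /Rpower; auto_derive; lra.
Qed.

Lemma heat_kernel_ge0 alpha theta beta t : 0 < alpha -> 0 <= heat_kernel alpha theta beta t.
Proof.
move=> a0; have := exp_pos (- theta * ln t); rewrite -/(Rpower t (- theta)) => Hp.
by apply: Rmult_le_pos; [apply: Rmult_le_pos; lra | apply: Rlt_le; exact: exp_pos].
Qed.

Theorem theorem3p5 (d : nat) (hd : (2 <= d)%N)
  (k : nat) (X : tensor_space d k) (Y : tensor_space d 1)
  (E : R -> Y -> Y) (hE : heat_semigroup Y E)
  (D : X -> Prop) (B : X -> Y) (hB : densely_defined_linear D B)
  (EB : R -> X -> Y) (hEB : bounded_composition E D B EB)
  (alpha beta sigma theta : R)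
  (htheta : 0 <= theta < 1) (halpha : 0 < alpha) (hsigma : 0 < sigma < beta)
  (hXY : existT (tensor_space d) k X = existT (tensor_space d) 1%N Y ->
         theta = 0 /\ alpha = 1)
  (hY : forall (t : R) (y : Y), 0 < t ->
         norm (E t y) <= exp (- sigma * t) * norm y)
  (hX : forall (t : R) (w : X), 0 < t ->
         norm (EB t w)
         <= alpha * (Rpower t (- theta) + 1) * exp (- beta * t) * norm w)
  (u0 : Y) (f : R -> X) (hf : AAP f) :
  let M := alpha * (Rpower beta (theta - 1) * Gamma (1 - theta) + / beta) in
  exists u : R -> Y,
    (AAP u /\ mild_solution E EB u0 f u) /\
    (forall v : R -> Y, AAP v /\ mild_solution E EB u0 f v ->
       forall t, 0 <= t -> v t = u t) /\
    Rbar_le (sup_norm Rplus_set u)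
            (Rbar_plus (norm u0) (Rbar_mult M (sup_norm Rplus_set f))).
Proof.
move=> M; have b0 : 0 < beta by lra.
apply: (AAP_mild_solution E EB (heat_kernel alpha theta beta) M sigma) => //.
- by case: hE.
- by lra.
- by move=> t t0; case: (hEB t t0).
- by move=> r s w; apply: (semigroup_composition E D B) => //; case: hE.
- by move=> t _; exact: heat_kernel_ge0.
- exact: heat_kernel_continuous.
- exact: heat_kernel_integral.
Qed.
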